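(* Let $k\ge 2$ be an integer and let $q_1\ge q_2\ge\cdots\ge q_k\ge 1$ be integers. Let $\{\mathcal{U}^{(k)}_n\}_{n\ge 0}$ be the integer sequence with $\mathcal{U}^{(k)}_i=0$ for $0\le i<k-1$, $\mathcal{U}^{(k)}_{k-1}=1$, and $\mathcal{U}^{(k)}_n=\sum_{i=1}^k q_i\,\mathcal{U}^{(k)}_{n-i}$ for $n\ge k$. Let $f(x)=x^k-q_1x^{k-1}-q_2x^{k-2}-\cdots-q_{k-1}x-q_k$. Then there exist real constants $c>0$ and $d>1$ such that $$\mathcal{U}^{(k)}_n=c\,\alpha^n+\mathcal{O}(d^{-n})\qquad (n\to\infty),$$ where $\alpha\in(q_1,q_1+1)$ is the positive real zero of $f$. Furthermore, $$\lim_{n\to\infty}\frac{\mathcal{U}^{(k)}_n}{\mathcal{U}^{(k)}_{n-1}}=\alpha .$$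
   Context: Under the stated assumptions on $q_1,\dots,q_k$, it is known that $f$ has exactly one positive real zero $\alpha$, and that $q_1<\alpha<q_1+1$. *)

(* Defs.v *)
From HB Require Import structures.
From mathcomp Require Import all_boot all_order all_algebra.
From mathcomp Require Import all_classical all_reals all_analysis.

Set Implicit Arguments.
Unset Strict Implicit.
Unset Printing Implicit Defensive.

Import Order.TTheory GRing.Theory Num.Theory.
Import numFieldNormedType.Exports.

Local Open Scope classical_set_scope.
Local Open Scope ring_scope.

(* The coefficients q_1, ..., q_k are the values of [q : nat -> int] at
   1, ..., k; the other values of [q] are never used. *)
Definition genfib_coefs (k : nat) (q : nat -> int) : Prop :=
  (forall i : nat, (1 <= i < k)%N -> q i.+1 <= q i) /\ 1 <= q k.

Definition is_genfib (k : nat) (q : nat -> int) (U : nat -> int) : Prop :=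
  [/\ forall i : nat, (i < k - 1)%N -> U i = 0,
      U (k - 1)%N = 1 &
      forall n : nat, (k <= n)%N ->
        U n = \sum_(1 <= i < k.+1) q i * U (n - i)%N].

Definition genfib_charpoly (R : realType) (k : nat) (q : nat -> int) :
    {poly R} :=
  'X^k - \sum_(1 <= i < k.+1) (q i)%:~R *: 'X^(k - i).

(* Main.v *)
Require Import Defs.
From HB Require Import structures.
From mathcomp Require Import all_boot all_order all_algebra.
From mathcomp Require Import all_classical all_reals all_analysis.
From mathcomp Require Import zify ring lra.

(* Dividing [f] by ['X - alpha] leaves [g] with coefficients [1 = b_0, ...,
   b_(k-1)], where [b_(j+1) = alpha b_j - q_(j+1)] and [b_k = f(alpha) = 0].
   Read backwards from [b_k = 0], this recursion and the monotonicity of [q]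
   give [b_0 > b_1 > ... > b_(k-1) > 0]; in particular [g > 0] on the positive
   reals.  Put [c = 1 / g(alpha)].  The sums
   [b_0 U_(n+k-1) + ... + b_(k-1) U_n] form a geometric sequence of ratio
   [alpha], so [E_n = U_n - c alpha^n] satisfies the recurrence with
   characteristic polynomial [g].  For [d > 1] close to 1 the coefficients
   [b_j d^j] are still decreasing, and they give the recurrence satisfied by
   [d^n E_n].  The Enestrom-Kakeya trick of multiplying by ['X - 1] turns it
   into one expressing each term as a convex combination of the [k] preceding
   ones, whence [d^n E_n] is bounded. *)

Set Implicit Arguments.
Unset Strict Implicit.
Unset Printing Implicit Defensive.

Import Order.TTheory GRing.Theory Num.Theory.
Import numFieldNormedType.Exports.

Local Open Scope classical_set_scope.
Local Open Scope ring_scope.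

(* For [u n = x ^+ n] and [N = k] this is the factorization
   [f(x) = (x - a) g(x)]; for general [u] it is the corresponding
   factorization of the shift operator. *)
Lemma sum_deflate (R : comPzRingType) (b q u : nat -> R) (a : R) (k N : nat) :
    (forall j, (j < k)%N -> b j.+1 = a * b j - q j.+1) -> b k = 0 ->
  \sum_(j < k) b j * u (N - j)%N - a * (\sum_(j < k) b j * u (N - j.+1)%N) =
  b 0%N * u N - \sum_(j < k) q j.+1 * u (N - j.+1)%N.
Proof.
move=> bS bk0; rewrite mulr_sumr -sumrB.
have -> : b 0%N * u N =
    \sum_(j < k) (b j * u (N - j)%N - b j.+1 * u (N - j.+1)%N).
  rewrite -(big_mkord xpredT
    (fun j => b j * u (N - j)%N - b j.+1 * u (N - j.+1)%N)).
  under eq_bigr => j _ do rewrite -opprB.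
  by rewrite sumrN telescope_sumr // bk0 mul0r sub0r opprK subn0.
rewrite -sumrB; apply: eq_bigr => j _.
by rewrite bS //; ring.
Qed.

(** Subtracting two consecutive instances of the recurrence, via [sum_deflate] at [a = 1], isolates
    [y n]. The weights [w j - w j.+1] are nonnegative and telescope to 1, so a bound on the first
    [k] terms propagates. *)
Lemma decreasing_recurrence_bounded (R : realDomainType) (w y : nat -> R)
    (k : nat) :
    w 0%N = 1 -> w k = 0 -> (forall j, (j < k)%N -> w j.+1 <= w j) ->
    (forall n, \sum_(j < k) w j * y (n + k - j.+1)%N = 0) ->
  exists M, forall n, `|y n| <= M.
Proof.
move=> w0 wk wdec hy; exists (\sum_(i < k) `|y i|) => n.
elim/ltn_ind: n => n IH; case: (ltnP n k) => [nk|kn].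
  by rewrite (bigD1 (Ordinal nk)) //= lerDl sumr_ge0.
have -> : y n = \sum_(j < k) (w j - w j.+1) * y (n - j.+1)%N.
  have hS : forall j, (j < k)%N -> w j.+1 = 1 * w j - (w j - w j.+1).
    by move=> j _; ring.
  have := sum_deflate (q := fun j => w j.-1 - w j) y n hS wk.
  have := hy (n - k)%N; have := hy (n - k).+1.
  rewrite addSn subnK // => -> ->.
  by rewrite mulr0 subrr w0 mul1r => /esym/eqP; rewrite subr_eq0 => /eqP.
apply: le_trans (ler_norm_sum _ _ _) _.
set M := \sum_(i < k) `|y i| in IH *.
have -> : M = \sum_(j < k) (w j - w j.+1) * M.
  rewrite -mulr_suml -[LHS]mul1r; congr (_ * _).
  rewrite -(big_mkord xpredT (fun j => w j - w j.+1)).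
  under eq_bigr => j _ do rewrite -opprB.
  by rewrite sumrN telescope_sumr // w0 wk sub0r opprK.
apply: ler_sum => j _; rewrite normrM ger0_norm ?subr_ge0 ?wdec //.
apply: ler_wpM2l; first by rewrite subr_ge0 wdec.
by apply: IH; rewrite ltn_subrL (leq_trans _ kn) // (leq_ltn_trans _ (ltn_ord j)).
Qed.

Lemma strictly_decreasing_ratio (R : realFieldType) (b : nat -> R) (k : nat) :
    (forall j, (j < k)%N -> 0 <= b j.+1 < b j) ->
  exists2 r, 1 < r & forall j, (j < k)%N -> r * b j.+1 <= b j.
Proof.
elim: k => [|k IH] hb; first by exists 2; rewrite ?ltr1n.
have [j jk|r r1 hr] := IH; first exact/hb/ltnW.
have /andP[bk0 bkS] := hb k (ltnSn k).
have s0 : 0 < b k + b k.+1 by lra.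
exists (Num.min r (b k *+ 2 / (b k + b k.+1))).
  by rewrite lt_min r1 ltr_pdivlMr //; lra.
move=> j; rewrite ltnS leq_eqVlt => /orP[/eqP->|jk].
  apply: (@le_trans _ _ (b k *+ 2 / (b k + b k.+1) * b k.+1)).
    by apply: ler_wpM2r => //; rewrite ge_min lexx orbT.
  rewrite mulrAC ler_pdivrMr //; nra.
apply: le_trans (hr j jk); apply: ler_wpM2r; last by rewrite ge_min lexx.
by have /andP[] := hb j (ltnW jk).
Qed.

(** Horner's scheme for division by ['X - a]: the quotient's coefficients from the leading one down,
    then the remainder at index [k]. *)
Fixpoint deflate_coef (R : pzRingType) (a : R) (q : nat -> R) (j : nat) : R :=
  if j is j'.+1 then a * deflate_coef a q j' - q j else 1.

Lemma deflate_coefE (R : comPzRingType) (a : R) (q : nat -> R) (k : nat) :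
  deflate_coef a q k = a ^+ k - \sum_(j < k) q j.+1 * a ^+ (k - j.+1).
Proof.
elim: k => [|k IH] /=; first by rewrite big_ord0 subr0.
rewrite IH big_ord_recr /= subnn expr0 mulr1 mulrBr -exprS mulr_sumr.
rewrite opprD addrA; congr (_ - _ - _); apply: eq_bigr => j _.
by rewrite mulrCA -exprS subSS subnSK.
Qed.

Lemma deflate_coef_decr (R : realFieldType) (a : R) (q : nat -> R) (k : nat) :
    0 < a -> (forall i, (1 <= i < k)%N -> q i.+1 <= q i) -> 0 < q k ->
    deflate_coef a q k = 0 ->
  forall j, (j < k)%N -> 0 <= deflate_coef a q j.+1 < deflate_coef a q j.
Proof.
move=> a0 qdec qk bk0.
suff H i : (i < k)%N -> 0 <= deflate_coef a q (k - i)
                        < deflate_coef a q (k - i.+1).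
  move=> j jk; have := H (k - j.+1)%N; rewrite subKn // subnSK // subKn ?(ltnW jk) //.
  by apply; rewrite leq_subr.
elim: i => [|i IH] ik.
  rewrite subn0 bk0 lexx /= -(pmulr_rgt0 _ a0).
  by case: k ik bk0 qk {qdec} => // k _ /= /eqP; rewrite subr_eq0 subn1 => /eqP->.
have /andP[h0 h1] := IH (ltnW ik).
rewrite (le_trans h0 (ltW h1)) /=.
have [m Em] : exists m, (k - i.+2)%N = m by eexists.
have E1 : (k - i.+1)%N = m.+1 by rewrite -Em subnSK.
have E0 : (k - i)%N = m.+2 by rewrite -E1 subnSK // ltnW.
have mk : (1 <= m.+1 < k)%N by rewrite -E1 subn_gt0 ik ltn_subrL (leq_ltn_trans _ ik).
rewrite E0 E1 in h0 h1; rewrite E1 Em -(ltr_pM2l a0).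
(* With [b] the deflated coefficients, [a (b_m - b_(m+1)) = (b_(m+1) - b_(m+2)) + (q_(m+1) -
   q_(m+2))], a positive plus a nonnegative term. *)
have := qdec _ mk; move: h1 => /=.
lra.
Qed.

Lemma genfib_coefs_bounds (k : nat) (q : nat -> int) (i : nat) :
  genfib_coefs k q -> (1 <= i <= k)%N -> 1 <= q i <= q 1%N.
Proof.
move=> [qdec qk1] /andP[i0 ik]; apply/andP; split.
  rewrite -(subKn ik); have: (k - i < k)%N by lia.
  elim: (k - i)%N => [|m IH] mk; first by rewrite subn0.
  apply: le_trans (IH (ltnW mk)) _.
  by rewrite -(@subnSK m k) 1?ltnW //; apply: qdec; lia.
elim: i i0 ik => // -[//|i] IH _ ik; apply: le_trans (IH _ (ltnW ik)) => //.
exact: qdec.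
Qed.

Lemma horner_genfib_charpoly (R : realType) (k : nat) (q : nat -> int) (x : R) :
  (genfib_charpoly R k q).[x] =
  x ^+ k - \sum_(j < k) (q j.+1)%:~R * x ^+ (k - j.+1).
Proof.
rewrite /genfib_charpoly !hornerE; congr (_ - _).
rewrite horner_sum big_add1 big_mkord.
by apply: eq_bigr => j _; rewrite !hornerE.
Qed.

Lemma genfib_charpoly_root_between (R : realType) (k : nat) (q : nat -> int) :
    (2 <= k)%N -> genfib_coefs k q ->
  exists2 alpha : R, (q 1%N)%:~R < alpha < (q 1%N)%:~R + 1 &
                     root (genfib_charpoly R k q) alpha.
Proof.
move=> hk /genfib_coefs_bounds qge1.
set p := genfib_charpoly R k q; set A : R := (q 1%N)%:~R.
have A1 : 1 <= A by rewrite -[1]/(1%:~R) ler_int; case/andP: (qge1 1%N (ltnW hk)).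
have A0 : 0 < A := lt_le_trans ltr01 A1.
have qR i : (1 <= i <= k)%N -> (1 : R) <= (q i)%:~R <= A.
  by move=> /qge1; rewrite -[1 : R]/(1%:~R) !ler_int.
(* The leading power cancels against the [q_1] term; as [k >= 2], a positive sum is still
   subtracted. *)
have pA : p.[A] < 0.
  rewrite horner_genfib_charpoly; case: k hk {p} qR {qge1} => // -[//|k] _ qR.
  rewrite big_ord_recl /= subSS subn0 -exprS opprD addrA subrr sub0r oppr_lt0.
  rewrite big_ord_recl; apply: ltr_pwDl.
    by rewrite mulr_gt0 ?exprn_gt0 // (lt_le_trans ltr01) //; case/andP: (qR 2%N isT).
  apply: sumr_ge0 => i _; rewrite mulr_ge0 ?exprn_ge0 ?(ltW A0) //.
  apply: (le_trans ler01); rewrite /= /bump /=.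
  by have /andP[] := qR i.+3 (ltn_ord i).
(* Raising every [q_i] to [A] makes the subtracted sum geometric, with value [(A + 1) ^+ k - 1]. *)
have pA1 : 0 < p.[A + 1].
  rewrite horner_genfib_charpoly subr_gt0.
  apply: (@le_lt_trans _ _ ((A + 1) ^+ k - 1)); last by rewrite ltrBlDr ltrDl ltr01.
  rewrite subrX1 addrK mulr_sumr [leRHS](reindex_inj rev_ord_inj) /=.
  apply: ler_sum => i _; apply: ler_wpM2r; first by rewrite exprn_ge0 // addr_ge0 // ltW.
  by have /andP[] := qR i.+1 (ltn_ord i).
have [||x /andP[Ax xA] rx] := @poly_ivt _ p A (A + 1).
- by rewrite lerDl.
- by rewrite !ltW.
exists x => //; rewrite !lt_neqAle Ax xA !andbT; apply/andP; split.
  by apply: contraTneq rx => <-; rewrite rootE lt_eqF.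
by apply: contraTneq rx => ->; rewrite rootE gt_eqF.
Qed.

Lemma bounded_mul_expr_cvg0 (R : realType) (e : nat -> R) (d M : R) :
  1 < d -> (forall n, `|e n * d ^+ n| <= M) -> e @ \oo --> 0.
Proof.
move=> d1 hM.
have d0 : 0 < d := lt_trans ltr01 d1.
have c0 : (fun n => M * d^-1 ^+ n) @ \oo --> 0.
  rewrite -[X in _ --> X](mulr0 M); apply: cvgM; first exact: cvg_cst.
  by apply: cvg_expr; rewrite gtr0_norm ?invr_gt0 // invf_lt1.
apply/norm_cvg0P; apply: (squeeze_cvgr _ (cvg_cst 0) c0).
apply: nearW => n; rewrite normr_ge0 /= exprVn ler_pdivlMr ?exprn_gt0 //.
by rewrite -[d ^+ n in leLHS]ger0_norm ?exprn_ge0 ?(ltW d0) // -normrM.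
Qed.

Theorem theorem2p9 (R : realType) (k : nat) (q U : nat -> int)
    (hk : (2 <= k)%N) (hq : genfib_coefs k q) (hU : is_genfib k q U) :
  exists alpha : R,
    [/\ (q 1%N)%:~R < alpha < (q 1%N)%:~R + 1,
        root (genfib_charpoly R k q) alpha,
        forall x : R, 0 < x -> root (genfib_charpoly R k q) x -> x = alpha,
        exists c d : R,
          [/\ 0 < c, 1 < d &
              (fun n : nat => (U n)%:~R : R) =
                (fun n : nat => c * alpha ^+ n) +O_\oo (fun n : nat => d ^- n)]
      & (fun n : nat => (U n)%:~R / (U (n - 1)%N)%:~R : R) @ \oo --> alpha].
Proof.
have [a haq ra] := genfib_charpoly_root_between R hk hq.
have [qdec qk1] := hq; have [U0 U1 Urec] := hU.
have k0 : (0 < k)%N := ltnW hk.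
have a1 : 1 < a.
  have /andP[q11 _] : 1 <= q 1%N <= q 1%N by apply: (genfib_coefs_bounds hq).
  by case/andP: haq => + _; apply: le_lt_trans; rewrite -[1]/(1%:~R) ler_int.
have a0 : 0 < a := lt_trans ltr01 a1.
pose qR i : R := (q i)%:~R; pose b := deflate_coef a qR.
have bk : b k = 0.
  by rewrite /b deflate_coefE -horner_genfib_charpoly; exact/eqP.
have bdec : forall j, (j < k)%N -> 0 <= b j.+1 < b j.
  apply: deflate_coef_decr => //; first by move=> i /qdec; rewrite ler_int.
  by rewrite ltr0z (lt_le_trans ltr01).
have bpos j : (j < k)%N -> 0 < b j.
  by move=> /bdec /andP[]; apply: le_lt_trans.
have bS j : (j < k)%N -> b j.+1 = a * b j - qR j.+1 by [].
pose g x := \sum_(j < k) b j * x ^+ (k - j.+1).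
have gpos x : 0 < x -> 0 < g x.
  move=> x0; rewrite /g (bigD1 (Ordinal k0)) //=.
  apply: ltr_pwDl; first by rewrite mulr_gt0 ?exprn_gt0.
  by apply: sumr_ge0 => j _; rewrite mulr_ge0 ?exprn_ge0 ?(ltW x0) ?ltW ?bpos.
pose c := (g a)^-1.
have c0 : 0 < c by rewrite invr_gt0 gpos.
pose E n : R := (U n)%:~R - c * a ^+ n.
(* At [n = 0] only [U (k - 1) = 1] contributes. Each shift multiplies the sum by [a], because the
   right-hand side of [sum_deflate] vanishes by the recurrence for [U]. *)
have Urec' n : \sum_(j < k) b j * (U (n + k - j.+1)%N)%:~R = a ^+ n.
  elim: n => [|n IH].
    rewrite add0n (bigD1 (Ordinal k0)) //= U1 mulr1 big1 ?addr0 // => j.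
    rewrite -val_eqE /= => j0; rewrite U0 ?mulr0 // ltn_sub2l ?lt0n //.
    by rewrite ltnS lt0n.
  have := sum_deflate (fun n => (U n)%:~R) (n + k)%N bS bk.
  rewrite IH -exprS mul1r Urec ?leq_addl // big_add1 big_mkord rmorph_sum /=.
  under [X in _ - _ = X - _]eq_bigr => j _ do rewrite rmorphM.
  rewrite subrr => /eqP; rewrite subr_eq0 => /eqP <-.
  by apply: eq_bigr => j _; rewrite addSn subSS.
have Erec n : \sum_(j < k) b j * E (n + k - j.+1)%N = 0.
  under eq_bigr => j _ do rewrite mulrBr.
  rewrite sumrB Urec'; apply/eqP; rewrite subr_eq0; apply/eqP.
  (* This is where [c] is fixed: the same weighted sum over [c * a ^+ n] equals [c * a ^+ n * g a],
     that is [a ^+ n]. *)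
  rewrite -[LHS](mulfVK (lt0r_neq0 (gpos a a0))) -/c -mulrA mulr_sumr mulr_sumr.
  apply: eq_bigr => j _; rewrite -addnBA // exprD.
  by ring.
have [d d1 hd] := strictly_decreasing_ratio bdec.
have d0 : 0 < d := lt_trans ltr01 d1.
have [M hM] : exists M, forall n, `|E n * d ^+ n| <= M.
  apply: (@decreasing_recurrence_bounded _ (fun j => b j * d ^+ j) _ k).
  - by rewrite expr0 mulr1.
  - by rewrite bk mul0r.
  - by move=> j jk; rewrite exprS mulrA ler_pM2r ?exprn_gt0 // mulrC hd.
  - move=> n.
    transitivity ((\sum_(j < k) b j * E (n + k - j.+1)%N) * d ^+ (n + k).-1).
      rewrite mulr_suml; apply: eq_bigr => j _.
      have -> : (n + k).-1 = (n + k - j.+1 + j)%N by have := ltn_ord j; lia.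
      by rewrite exprD; ring.
    by rewrite Erec mul0r.
exists a; split => //.
(* Here [f(x) = (x - a) * g x] and [g x > 0], so only the first factor can vanish. *)
- move=> x x0 rx; apply/eqP; rewrite -subr_eq0.
  have := sum_deflate (fun n => x ^+ n) k bS bk.
  rewrite mul1r -horner_genfib_charpoly (eqP rx) -/(g x).
  have -> : \sum_(j < k) b j * x ^+ (k - j) = x * g x.
    by rewrite mulr_sumr; apply: eq_bigr => j _; rewrite mulrCA -exprS subnSK.
  by move/eqP; rewrite -mulrBl mulf_eq0 (gt_eqF (gpos x x0)) orbF.
- exists c, d; split => //; apply/eqaddOP; exists M; split; first exact: num_real.
  move=> K MK; apply: nearW => n /=.
  rewrite -[leLHS]/`|E n| normfV [X in _ / X]gtr0_norm ?exprn_gt0 //.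
  rewrite ler_pdivlMr ?exprn_gt0 //.
  rewrite -[d ^+ n]gtr0_norm ?exprn_gt0 // -normrM.
  exact: le_trans (hM n) (ltW MK).
- pose u n : R := (U n)%:~R / a ^+ n.
  have E0 := bounded_mul_expr_cvg0 d1 hM.
  have uc : u @ \oo --> c.
    have -> : u = (fun n => c + E n * a^-1 ^+ n).
      apply/funext => n; rewrite /u /E exprVn mulrBl mulfK ?expf_neq0 ?gt_eqF //.
      by ring.
    rewrite -[X in _ --> X]addr0; apply: cvgD; first exact: cvg_cst.
    rewrite -[X in _ --> X](mulr0 0); apply: cvgM => //.
    by apply: cvg_expr; rewrite gtr0_norm ?invr_gt0 // invf_lt1.
  (* Shifting the index removes the truncated [n - 1] at 0. The identity below holds for every [n]:
     when [U n = 0], both quotients are 0 since the inverse of 0 is 0. *)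
  rewrite -(cvg_shiftS (fun n => (U n)%:~R / (U (n - 1)%N)%:~R : R)).
  have -> : (fun n => (U n.+1)%:~R / (U (n.+1 - 1)%N)%:~R : R) =
            (fun n => a * (u n.+1 / u n)).
    apply/funext => n; rewrite /u subn1 /= exprS !invfM invrK.
    rewrite -[LHS]mul1r -[X in X * _ = _](divff (expf_neq0 n (lt0r_neq0 a0))).
    rewrite -[X in X * _ * _ = _]mul1r -[X in X * _ * _ * _ = _](divff (lt0r_neq0 a0)).
    by ring.
  have {2}-> : a = a * (c / c) by rewrite divff ?mulr1 ?gt_eqF.
  apply: cvgM; first exact: cvg_cst.
  apply: cvgM; first by rewrite (cvg_shiftS u).
  by apply: cvgV => //; exact: lt0r_neq0.
Qed.
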